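(* Let $\mathfrak C$ be a left cancellative small category. The canonical projection $I_l\ltimes\partial\Omega\twoheadrightarrow I_l\,\bar\ltimes\,\partial\Omega$ is an isomorphism (of topological groupoids) if one of the following holds: (i) The canonical projection $I_l\ltimes\Omega\twoheadrightarrow I_l\,\bar\ltimes\,\Omega$ is an isomorphism. (ii) $I_l\ltimes\partial\Omega$ is Hausdorff. (iii) $\partial\Omega=\Omega_{\max}$.
   Context: $\mathfrak C$ denotes the set of morphisms, $\mathfrak C^0\subseteq\mathfrak C$ the identity morphisms, $\mathfrak d,\mathfrak t$ domain and target; $cd$ is defined iff $\mathfrak d(c)=\mathfrak t(d)$; left cancellative means $cx=cy\Rightarrow x=y$. Each $c\in\mathfrak C$ gives the partial bijection $\mathfrak d(c)\mathfrak C\to c\mathfrak C$, $x\mapsto cx$; $I_l$ is the smallest semigroup of partial bijections of $\mathfrak C$ containing these and closed under inverses; $\mathcal J=\{\mathrm{dom}(s):s\in I_l\}$ is its semilattice of idempotents (product = intersection). $\bar{\mathcal J}$ is the set of subsets $\varepsilon=e\setminus\bigcup_{i=1}^nf_i$ with $e,f_i\in\mathcal J$, $f_i\subseteq e$. $\widehat{\mathcal J}$ is the space of non-zero multiplicative maps $\chi:\mathcal J\to\{0,1\}$ with $\chi(\emptyset)=0$ if $\emptyset\in\mathcal J$ (pointwise convergence). $\Omega\subseteq\widehat{\mathcal J}$ consists of those $\chi$ such that whenever $e=\bigcup_{i=1}^nf_i$ ($e,f_i\in\mathcal J$) and $\chi(e)=1$, then $\chi(f_i)=1$ for some $i$. $\Omega_{\max}\subseteq\Omega$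 is the set of $\chi\in\widehat{\mathcal J}$ with $\chi^{-1}(1)$ maximal, and $\partial\Omega=\overline{\Omega_{\max}}$. For $\chi\in\Omega$, $\varepsilon=e\setminus\bigcup f_i\in\bar{\mathcal J}$, put $\chi(\varepsilon)=1$ iff $\chi(e)=1$ and all $\chi(f_i)=0$, and $\chi(\varepsilon)=0$ otherwise. $s\in I_l$ acts by $\chi\mapsto s.\chi=\chi(s^{-1}\cdot s)$ from $\{\chi\in\Omega:\chi(s^{-1}s)=1\}$ onto $\{\chi\in\Omega:\chi(ss^{-1})=1\}$; $\partial\Omega$ is invariant. For $Y=\Omega$ or $Y=\partial\Omega$: $I_l\ltimes Y$ is the quotient of $\{(s,\chi)\in I_l\times Y:\chi(s^{-1}s)=1\}$ by $(s,\chi)\sim(t,\psi)$ iff $\chi=\psi$ and $se=te$ for some $e\in\mathcal J$ with $\chi(e)=1$; $I_l\,\bar\ltimes\,Y$ is the quotient by $(s,\chi)\bar\sim(t,\psi)$ iff $\chi=\psi$ and $s\varepsilon=t\varepsilon$ for some $\varepsilon\in\bar{\mathcal J}$ with $\chi(\varepsilon)=1$ (restrictions as partial bijections). Both are groupoids with source $\chi$, range $s.\chi$, $[s,t.\chi][t,\chi]=[st,\chi]$, topologized such that the images of $\{s\}\times\{\chi\in Y:\chi(s^{-1}s)=1\}$ are open and mapped homeomorphically by the source map onto $\{\chi\in Y:\chi(s^{-1}s)=1\}$. The canonical projections send $\sim$-classes to $\bar\sim$-classes. *)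

(* Defs.v *)
From HB Require Import structures.
From mathcomp Require Import all_boot generic_quotient.
From mathcomp Require Import all_classical all_reals topology.

Set Implicit Arguments.
Unset Strict Implicit.
Unset Printing Implicit Defensive.

Local Open Scope classical_set_scope.

(* Small categories, presented by their morphisms only: objects are identified
   with identity morphisms.  [comp c d] is the composite c d; it is a total
   function, but its value is meaningless unless [dom c = tgt d]. *)
Record smallCategory := SmallCategory {
  mor :> Type;
  ident : set mor;
  dom : mor -> mor;
  tgt : mor -> mor;
  comp : mor -> mor -> mor;
  ident_dom : forall c, ident (dom c);
  ident_tgt : forall c, ident (tgt c);
  dom_ident : forall v, ident v -> dom v = v;
  tgt_ident : forall v, ident v -> tgt v = v;
  dom_comp : forall c d, dom c = tgt d -> dom (comp c d) = dom d;
  tgt_comp : forall c d, dom c = tgt d -> tgt (comp c d) = tgt c;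
  comp_dom : forall c, comp c (dom c) = c;
  comp_tgt : forall c, comp (tgt c) c = c;
  compA : forall b c d, dom b = tgt c -> dom c = tgt d ->
    comp b (comp c d) = comp (comp b c) d
}.

Definition left_cancellative (C : smallCategory) :=
  forall c x y : C, dom c = tgt x -> dom c = tgt y ->
    comp c x = comp c y -> x = y.

Record lcCategory := LcCategory {
  lc_cat :> smallCategory;
  lc_catP : left_cancellative lc_cat
}.

Section PartialBijections.
Context {T : Type}.

(* [None] means undefined. *)
Record pbij := PBij {
  pfun :> T -> option T;
  pfunV : T -> option T;
  pfunP : forall x y, pfun x = Some y <-> pfunV y = Some x
}.

HB.instance Definition _ := gen_eqMixin pbij.
HB.instance Definition _ := gen_choiceMixin pbij.

Definition pbij_dom (s : pbij) : set T := [set x | exists y, s x = Some y].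

Definition pbij_pre (s : pbij) (E : set T) : set T :=
  [set x | exists2 y, s x = Some y & E y].

Lemma pbij_eq (s t : pbij) : (forall x, s x = t x) -> s = t.
Proof.
case: s t => [f f' fP] [g g' gP] /= /funext fg; subst g.
have fg' : f' = g'.
  apply/funext => y.
  case E : (f' y) => [x|]; first by move: E => /fP/gP.
  by case E' : (g' y) => [x|//]; move: E' => /gP/fP; rewrite E.
by subst g'; congr PBij; exact: Prop_irrelevance.
Qed.

Lemma pcompP (s t : T -> option T) x z :
  pcomp s t x = Some z <-> exists2 y, t x = Some y & s y = Some z.
Proof.
rewrite /pcomp; case: (t x) => [y|] /=; last by split => // -[].
by split=> [sz|[_ [<-]]//]; exists y.
Qed.

Program Definition pbij_comp (s t : pbij) : pbij :=
  @PBij (pcomp s t) (pcomp (pfunV t) (pfunV s)) _.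
Next Obligation.
split=> /pcompP[z] h1 h2; apply/pcompP.
  by exists z; apply/pfunP.
by exists z; apply/pfunP.
Qed.

Definition pbij_inv (s : pbij) : pbij :=
  PBij (fun x y => iff_sym (pfunP s y x)).

Definition prestr (E : set T) (f : T -> option T) (x : T) : option T :=
  if `[< E x >] then f x else None.

Lemma prestrP E f x y : prestr E f x = Some y <-> E x /\ f x = Some y.
Proof.
rewrite /prestr; case: asboolP => [Ex|nEx]; first by split => [|[]].
by split => // -[].
Qed.

Program Definition pbij_restr (s : pbij) (E : set T) : pbij :=
  @PBij (prestr E s) (fun y => oapp (prestr E Some) None (pfunV s y)) _.
Next Obligation.
split=> [/prestrP[Ex /pfunP ->] /=|]; first exact/prestrP.
case sy : (pfunV s y) => [z|//] /= /prestrP[Ez [zx]].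
by subst z; apply/prestrP; split => //; exact/pfunP.
Qed.

Lemma pbij_restrP (s t : pbij) E :
  pbij_restr s E = pbij_restr t E <-> (forall x, E x -> s x = t x).
Proof.
split=> [st x Ex|st].
  have := congr1 (fun u : pbij => u x) st.
  by rewrite /= /prestr; case: asboolP.
by apply: pbij_eq => x /=; rewrite /prestr; case: asboolP => // /st.
Qed.

Lemma pbij_inj (s : pbij) x y z : s x = Some z -> s y = Some z -> x = y.
Proof. by move=> /pfunP sx /pfunP; rewrite sx => -[]. Qed.

End PartialBijections.
Arguments pbij : clear implicits.

Section Semigroup.
Variable C : lcCategory.

Definition lmul_fun (c x : C) : option C :=
  if `[< dom c = tgt x >] then Some (comp c x) else None.

Definition lmul_inv (c y : C) : option C :=
  if pselect (exists x, dom c = tgt x /\ comp c x = y) is left h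
  then Some (sval (cid h)) else None.

(* The partial bijection x |-> c x, from d(c)C (the x with t(x) = d(c)) onto
   cC. *)
Program Definition lmul (c : C) : pbij C := @PBij _ (lmul_fun c) (lmul_inv c) _.
Next Obligation.
rewrite /lmul_fun /lmul_inv; split.
  case: asboolP => // cx [<-]; case: pselect => [h|[]]; last by exists x.
  by case: cid => z /= [cz zx]; congr Some; exact: lc_catP zx.
case: pselect => // h; case: cid => z /= [cz zx] [<-].
by rewrite (asboolT cz) zx.
Qed.

Inductive in_Il : pbij C -> Prop :=
| in_Il_lmul c : in_Il (lmul c)
| in_Il_comp s t : in_Il s -> in_Il t -> in_Il (pbij_comp s t)
| in_Il_inv s : in_Il s -> in_Il (pbij_inv s).

Definition Il : set (pbij C) := [set s | in_Il s].

Definition J : set (set C) := [set pbij_dom s | s in Il].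

Lemma Il_compP (s t : Il) : pbij_comp (val s) (val t) \in Il.
Proof. by apply/mem_set/in_Il_comp; exact/set_mem/valP. Qed.
Definition Il_comp (s t : Il) : Il := exist (fun u => u \in Il) _ (Il_compP s t).

Lemma Il_invP (s : Il) : pbij_inv (val s) \in Il.
Proof. by apply/mem_set/in_Il_inv; exact/set_mem/valP. Qed.
Definition Il_inv (s : Il) : Il := exist (fun u => u \in Il) _ (Il_invP s).

Lemma Jdom_subproof (s : Il) : pbij_dom (val s) \in J.
Proof. by apply/mem_set; exists (val s) => //; exact/set_mem/valP. Qed.
(* The idempotent s^-1 s, identified with its domain. *)
Definition Jdom (s : Il) : J := exist (fun E => E \in J) _ (Jdom_subproof s).

Lemma Jdom_onto (e : J) : exists s : Il, Jdom s = e.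
Proof.
have [s sI sE] := set_mem (valP e).
by exists (exist (fun u => u \in Il) s (mem_set sI)); exact: val_inj.
Qed.

Lemma Jpre_subproof (s : Il) (e : J) : pbij_pre (val s) (val e) \in J.
Proof.
have [t <-] := Jdom_onto e; apply/mem_set.
exists (pbij_comp (val t) (val s)); first exact/set_mem/Il_compP.
apply/seteqP; split => x /=.
  by move=> [z /pcompP[y sxy tyz]]; exists y => //; exists z.
by move=> [y sxy [z tyz]]; exists z; apply/pcompP; exists y.
Qed.
(* The idempotent s^-1 e s, identified with its domain, which is the preimage of
   e under s. *)
Definition Jpre (s : Il) (e : J) : J := exist (fun E => E \in J) _ (Jpre_subproof s e).

Program Definition pbij_id : pbij C := @PBij _ Some Some _.
Next Obligation. by split=> -[->]. Qed.

Lemma Jid_subproof (e : J) : pbij_restr pbij_id (val e) \in Il.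
Proof.
have [s <-] := Jdom_onto e; apply/mem_set.
suff -> : pbij_restr pbij_id (val (Jdom s)) = pbij_comp (pbij_inv (val s)) (val s).
  exact/set_mem/(Il_compP (Il_inv s) s).
apply: pbij_eq => x /=; rewrite /prestr /pcomp; case: asboolP => /=.
  by move=> [y sy]; rewrite sy /=; apply/esym/pfunP.
by case E : (val s x) => [y|//] []; exists y.
Qed.
Definition Jid (e : J) : Il := exist (fun u => u \in Il) _ (Jid_subproof e).

Lemma Jmeet_subproof (e f : J) : val e `&` val f \in J.
Proof.
suff -> : val e `&` val f = val (Jpre (Jid e) f) by exact: valP.
apply/seteqP; split => x /=.
  by move=> [ex fx]; exists x => //; exact/prestrP.
by move=> [y /prestrP[ex [<-]] fx].
Qed.
Definition Jmeet (e f : J) : J := exist (fun E => E \in J) _ (Jmeet_subproof e f).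

End Semigroup.
Arguments Il : clear implicits.
Arguments J : clear implicits.

Section Characters.
Variable C : lcCategory.

(* All maps J -> {0,1}, with the topology of pointwise convergence. *)
Definition charspace := {ptws (J C) -> bool}.

HB.instance Definition _ := Topological.on charspace.

Definition Jhat : set charspace := [set chi : charspace |
  [/\ exists e, chi e,
      forall e f, chi (Jmeet e f) = chi e && chi f &
      forall e, val e = set0 -> chi e = false]].

Definition Omega : set charspace := [set chi : charspace | Jhat chi /\
  forall n (e : J C) (f : 'I_n -> J C), val e = \bigcup_i val (f i) ->
    chi e -> exists i, chi (f i)].

Definition Omega_max : set charspace := [set chi : charspace | Jhat chi /\
  forall psi : charspace, Jhat psi ->
    [set e | chi e] `<=` [set e | psi e] ->
    [set e | psi e] `<=` [set e | chi e]].

(* [closure] is taken in the space of all maps J -> {0,1}; intersecting with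
   [Jhat] (which removes at most the zero map) gives the closure in [Jhat]. *)
Definition bdOmega : set charspace := closure Omega_max `&` Jhat.

(* s.chi = chi(s^-1 _ s); a character only if chi(s^-1 s) = 1. *)
Definition act (s : Il C) (chi : charspace) : charspace :=
  fun e => chi (Jpre s e).

(* E is an element e \ (f_1 u ... u f_n), n >= 0, of \bar J with chi(E) = 1; for
   chi in Omega this does not depend on the choice of e and the f_i, see
   [bar_holdsE]. *)
Definition bar_holds (chi : charspace) (E : set C) :=
  exists n (e : J C) (f : 'I_n -> J C),
    [/\ forall i, val (f i) `<=` val e, E = val e `\` \bigcup_i val (f i),
        chi e & forall i, chi (f i) = false].

(* E is an element of J with chi(E) = 1. *)
Definition holds (chi : charspace) (E : set C) :=
  exists2 e : J C, E = val e & chi e.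

End Characters.
Arguments Jhat : clear implicits.
Arguments Omega : clear implicits.
Arguments Omega_max : clear implicits.
Arguments bdOmega : clear implicits.

Section CharacterTheory.
Variable C : lcCategory.

Lemma eval_continuous (e : J C) : continuous (fun chi : charspace C => chi e).
Proof. exact: (@proj_continuous (J C) (fun=> bool) e). Qed.

Lemma open_bool (X : topologicalType) (f : X -> bool) b :
  continuous f -> open [set x | f x = b].
Proof.
move=> /continuousP /(_ [set b]); apply.
exact: discrete_open.
Qed.

Lemma open_eval (e : J C) : open [set chi : charspace C | chi e].
Proof. exact: (open_bool true (@eval_continuous e)). Qed.

Lemma open_evalF (e : J C) : open [set chi : charspace C | chi e = false].
Proof. exact: (open_bool false (@eval_continuous e)). Qed.

Lemma act_continuous (s : Il C) : continuous (act s).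
Proof.
move=> chi; apply/cvg_sup => e A [_ [[B oB <-] Bx] sA].
apply: filterS sA _.
have /continuousP/(_ _ oB) := @eval_continuous (Jpre s e).
by move=> oB'; exact: (open_nbhs_nbhs (conj oB' Bx)).
Qed.

Lemma set_val_continuous (X : topologicalType) (A : set X) :
  continuous (val : A -> X).
Proof. exact: initial_continuous. Qed.

Lemma to_set_continuous (X Z : topologicalType) (A : set X) (f : Z -> A) :
  continuous (fun z => val (f z)) -> continuous f.
Proof.
move=> /continuousP cf; apply/continuousP => _ [B oB <-].
exact: cf.
Qed.

Lemma pre_comp (s t : Il C) (e : J C) : Jpre (Il_comp s t) e = Jpre t (Jpre s e).
Proof.
apply: val_inj; apply/seteqP; split => x /=.
  by move=> [z /pcompP[y ty sy] ez]; exists y => //; exists z.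
by move=> [y ty [z sz ez]]; exists z => //; apply/pcompP; exists y.
Qed.

Lemma act_comp (s t : Il C) chi : act (Il_comp s t) chi = act s (act t chi).
Proof. by apply/funext => e; rewrite /act pre_comp. Qed.

Lemma pre_dom (s t : Il C) : Jpre t (Jdom s) = Jdom (Il_comp s t).
Proof.
apply: val_inj; apply/seteqP; split => x /=.
  by move=> [y ty [z sz]]; exists z; apply/pcompP; exists y.
by move=> [z /pcompP[y ty sy]]; exists y => //; exists z.
Qed.

Lemma dom_compE (s t : Il C) chi : chi (Jdom (Il_comp s t)) = act t chi (Jdom s).
Proof. by rewrite /act pre_dom. Qed.

Lemma pre_inv (s : Il C) (e : J C) :
  Jpre s (Jpre (Il_inv s) e) = Jmeet (Jdom s) e.
Proof.
apply: val_inj; apply/seteqP; split => x /=.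
  move=> [y sy [z /pfunP sz ez]]; split; first by exists y.
  by rewrite (pbij_inj sy sz).
by move=> [[y sy] ex]; exists y => //; exists x => //; apply/pfunP.
Qed.

Lemma Il_invK (s : Il C) : Il_inv (Il_inv s) = s.
Proof. by apply: val_inj; apply: pbij_eq. Qed.

Lemma pre_range (s : Il C) : Jpre s (Jdom (Il_inv s)) = Jdom s.
Proof.
apply: val_inj; apply/seteqP; split => x /=; first by move=> [y sy _]; exists y.
by move=> [y sy]; exists y => //; exists x; apply/pfunP.
Qed.

Lemma act_range (s : Il C) chi : act s chi (Jdom (Il_inv s)) = chi (Jdom s).
Proof. by rewrite /act pre_range. Qed.

Lemma act_inv (s : Il C) chi :
  Jhat C chi -> chi (Jdom s) -> act (Il_inv s) (act s chi) = chi.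
Proof.
move=> [_ chiM _] sD; apply/funext => e.
by rewrite /act pre_inv chiM sD.
Qed.

Lemma act_invV (s : Il C) chi :
  Jhat C chi -> chi (Jdom (Il_inv s)) -> act s (act (Il_inv s) chi) = chi.
Proof. by move=> h1 h2; rewrite -{1}(Il_invK s) act_inv. Qed.

Lemma pre_meet (s : Il C) e f : Jpre s (Jmeet e f) = Jmeet (Jpre s e) (Jpre s f).
Proof.
apply: val_inj; apply/seteqP; split => x /=.
  by move=> [y sy [ey fy]]; split; exists y.
by move=> [[y sy ey] [z]]; rewrite sy => -[<-] fy; exists y.
Qed.

Lemma pre_bigcup (s : pbij C) I (F : I -> set C) :
  pbij_pre s (\bigcup_i F i) = \bigcup_i pbij_pre s (F i).
Proof.
apply/seteqP; split => x.
  by move=> [y sy [i _ Fi]]; exists i => //; exists y.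
by move=> [i _ [y sy Fi]]; exists y => //; exists i.
Qed.

Lemma act_Jhat (s : Il C) chi : Jhat C chi -> chi (Jdom s) -> Jhat C (act s chi).
Proof.
move=> [_ chiM chi0] sD; split.
- by exists (Jdom (Il_inv s)); rewrite act_range.
- by move=> e f; rewrite /act pre_meet chiM.
- move=> e e0; apply: chi0; rewrite /= e0.
  by apply/seteqP; split => x // [].
Qed.

Lemma act_Omega (s : Il C) chi : Omega C chi -> chi (Jdom s) -> Omega C (act s chi).
Proof.
move=> [chiJ chiO] sD; split; first exact: act_Jhat.
move=> n e f efE se.
by apply: (chiO n (Jpre s e) (fun i => Jpre s (f i))) => //=; rewrite efE pre_bigcup.
Qed.

Lemma Omega_max_sub : Omega_max C `<=` Omega C.
Proof.
move=> chi [chiJ chimax]; split=> // n e f efE che.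
apply: contrapT => /forallNP nf.
have [[e0 chi_e0] chiM chi0] := chiJ.
have sep i : exists e' : J C, chi e' /\ val e' `&` val (f i) = set0.
  apply: contrapT => /forallNP ns; apply: (nf i).
  pose psi : charspace C := fun g =>
    `[< exists2 e' : J C, chi e' & val e' `&` val (f i) `<=` val g >].
  have psiJ : Jhat C psi.
    split.
    - by exists e0; apply/asboolP; exists e0 => // x [].
    - move=> g h; apply/asboolP/andP.
        by move=> [e' ce' sub]; split; apply/asboolP; exists e' => // x /sub [].
      move=> [/asboolP[e1 c1 s1] /asboolP[e2 c2 s2]].
      exists (Jmeet e1 e2); first by rewrite chiM c1.
      by move=> x [[x1 x2] fx]; split; [exact: s1|exact: s2].
    - move=> g g0; apply/asboolP => -[e' ce']; rewrite g0 subset0 => e'0.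
      by apply: (ns e'); split.
  have : psi (f i) by apply/asboolP; exists e0 => // x [].
  apply: (chimax psi psiJ) => g /= cg.
  by apply/asboolP; exists g => // x [].
have [g gP] := choice sep.
have [m [cm me mg]] : exists m : J C, [/\ chi m, val m `<=` val e &
    forall i, val m `<=` val (g i)].
  have cg i : chi (g i) by case: (gP i).
  clear -cg che chiM; elim: n g cg => [|n IH] g cg.
    by exists e; split => // -[].
  have [m [cm me mg]] := IH (fun i => g (lift ord0 i)) (fun=> cg _).
  exists (Jmeet m (g ord0)); split; first by rewrite chiM cm cg.
    by move=> x [] /me.
  move=> i x [mx gx]; case: (unliftP ord0 i) => [j|] ->//.
  exact: mg.
have := chi0 m; rewrite cm => h; suff // : true = false by [].
apply: h; rewrite -subset0 => x mx.
have := me _ mx; rewrite efE => -[i _ fx].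
by have [_ <-] := gP i; split => //; exact: mg.
Qed.

Lemma act_Omega_max (s : Il C) chi :
  Omega_max C chi -> chi (Jdom s) -> Omega_max C (act s chi).
Proof.
move=> [chiJ chimax] sD; split; first exact: act_Jhat.
move=> psi psiJ sub.
have rD : psi (Jdom (Il_inv s)) by apply: sub; rewrite /= act_range.
have le := chimax (act (Il_inv s) psi) (act_Jhat psiJ rD) _.
move=> e pe; apply: le; last first.
  by rewrite /= -{1}(act_invV psiJ rD) in pe; exact: pe.
move=> f cf; apply: sub => /=.
by move: cf => /=; rewrite -[in chi f](act_inv chiJ sD).
Qed.

Lemma bdOmega_sub : bdOmega C `<=` Omega C.
Proof.
move=> chi [cl chiJ]; split => // n e f efE che.
apply: contrapT => /forallNP nf.
have nfF i : chi (f i) = false by apply/negbTE/negP/nf.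
have nb1 : nbhs chi [set psi : charspace C | psi e].
  exact: (open_nbhs_nbhs (conj (open_eval e) che)).
have nb2 : \forall psi \near chi, forall i, psi (f i) = false.
  apply: (@filter_forall _ _ (fun i (psi : charspace C) => psi (f i) = false) (nbhs chi) (nbhs_filter chi)) => i.
  exact: (open_nbhs_nbhs (conj (open_evalF (f i)) (nfF i))).
have [psi [/Omega_max_sub[_ psiO] [pe pf]]] := cl _ (filterI nb1 nb2).
by have [i] := psiO _ _ _ efE pe; rewrite pf.
Qed.

Lemma act_bdOmega (s : Il C) chi :
  bdOmega C chi -> chi (Jdom s) -> bdOmega C (act s chi).
Proof.
move=> [cl chiJ] sD; split; last exact: act_Jhat.
move=> B nB.
have nb1 : nbhs chi [set psi : charspace C | psi (Jdom s)].
  exact: (open_nbhs_nbhs (conj (open_eval (Jdom s)) sD)).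
have nb2 : nbhs chi (act s @^-1` B) by exact: act_continuous nB.
have [psi [pm [pB pD]]] := cl _ (filterI nb2 nb1).
by exists (act s psi); split => //; exact: act_Omega_max.
Qed.

Lemma holds_bar chi E : Jhat C chi -> holds chi E -> bar_holds chi E.
Proof.
move=> _ [e -> ce]; exists 0, e, (fun=> e); split => //; [by move=> _ x| |by case].
by rewrite bigcup0 ?setD0// => -[].
Qed.

Lemma bar_holdsE n (e : J C) (f : 'I_n -> J C) chi : Omega C chi ->
  (forall i, val (f i) `<=` val e) ->
  bar_holds chi (val e `\` \bigcup_i val (f i)) <->
  chi e /\ forall i, chi (f i) = false.
Proof.
move=> [[_ chiM chi0] chiO] fe; split=> [|[ce cf]]; last by exists n, e, f.
have bigcupcut m (g : J C) (h : 'I_m -> J C) : val g `<=` \bigcup_i val (h i) ->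
    (forall i, chi (h i) = false) -> chi g = false.
  move=> gh ch; apply/negbTE/negP => cg.
  have [|i] := chiO m g (fun i => Jmeet g (h i)) _ cg.
    apply/seteqP; split => x /=; last by move=> [i _ []].
    by move=> gx; have [i _ hx] := gh x gx; exists i.
  by rewrite chiM ch andbF.
move=> [m [e' [f' [fe' EE ce' cf']]]].
have sub : val e' `\` \bigcup_i val (f' i) `<=` val e `\` \bigcup_i val (f i).
  by rewrite EE.
have sub' : val e `\` \bigcup_i val (f i) `<=` val e' `\` \bigcup_i val (f' i).
  by rewrite EE.
have ce : chi e.
  have [|i] := chiO m.+1 e' (fun i => oapp f' (Jmeet e e') (unlift ord0 i)) _ ce'.
    apply/seteqP; split => x /=.
      move=> ex; have [[i _ fx]|nf] := pselect ((\bigcup_i val (f' i)) x).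
        by exists (lift ord0 i) => //; rewrite liftK.
      exists ord0 => //; rewrite unlift_none; split => //.
      by have [] := sub x (conj ex nf).
    by move=> [i _]; case: unliftP => [j _ /fe'|_ []].
  by case: unliftP => [j _|_] /=; rewrite ?cf'// chiM => /andP[].
split => // i; apply/negbTE/negP => cfi.
suff : chi (Jmeet e' (f i)) = false by rewrite chiM ce' cfi.
apply: (bigcupcut m _ f') => // x [ex fx].
apply: contrapT => nf; have [_] := sub x (conj ex nf); apply.
by exists i.
Qed.


Lemma holdsI chi E F : Jhat C chi -> holds chi E -> holds chi F ->
  holds chi (E `&` F).
Proof.
move=> [_ chiM _] [e -> ce] [f -> cf]; exists (Jmeet e f) => //.
by rewrite chiM ce.
Qed.

Lemma holds_pre (s : Il C) chi E : holds (act s chi) E -> holds chi (pbij_pre (val s) E).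
Proof. by move=> [e -> ce]; exists (Jpre s e). Qed.

Lemma holds_open E : open [set chi : charspace C | holds chi E].
Proof.
rewrite openE => chi [e -> ce].
apply: filterS (open_nbhs_nbhs (conj (open_eval e) ce)) => psi pe.
by exists e.
Qed.

Lemma bar_holdsI chi E F : Jhat C chi -> bar_holds chi E -> bar_holds chi F ->
  bar_holds chi (E `&` F).
Proof.
move=> [_ chiM _] [n [e [f [fe -> ce cf]]]] [m [e' [f' [fe' -> ce' cf']]]].
exists (n + m), (Jmeet e e'), (fun i => match fintype.split i with
  inl i => Jmeet (f i) e' | inr i => Jmeet e (f' i) end).
split.
- move=> i x; case: fintype.split => j /= [h1 h2]; split => //; first exact: fe h1.
  exact: fe' h2.
- apply/seteqP; split => x /=.
    move=> [[ex nf] [ex' nf']]; split => // -[i _]; case: fintype.split => j /= [h1 h2].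
      by apply: nf; exists j.
    by apply: nf'; exists j.
  move=> [[ex ex'] nf]; split; split => // -[i _ fx]; apply: nf.
    by exists (lshift m i) => //; rewrite (unsplitK (inl i)).
  by exists (rshift n i) => //; rewrite (unsplitK (inr i)).
- by rewrite chiM ce.
- by move=> i; case: fintype.split => j; rewrite chiM ?cf// cf' andbF.
Qed.

Lemma bar_holds_pre (s : Il C) chi E :
  bar_holds (act s chi) E -> bar_holds chi (pbij_pre (val s) E).
Proof.
move=> [n [e [f [fe -> ce cf]]]].
exists n, (Jpre s e), (fun i => Jpre s (f i)); split => //.
  by move=> i x [y sy fy]; exists y => //; exact: fe fy.
rewrite -pre_bigcup; apply/seteqP; split => x.
  move=> [y sy [ey nf]]; split; first by exists y.
  by move=> [z]; rewrite sy => -[<-].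
move=> [[y sy ey] nf]; exists y => //; split => // h.
by apply: nf; exists y.
Qed.

Lemma bar_holds_open E : open [set chi : charspace C | bar_holds chi E].
Proof.
rewrite openE => chi [n [e [f [fe EE ce cf]]]].
have nb1 : nbhs chi [set psi : charspace C | psi e].
  exact: (open_nbhs_nbhs (conj (open_eval e) ce)).
have nb2 : \forall psi \near chi, forall i, psi (f i) = false.
  apply: (@filter_forall _ _ (fun i (psi : charspace C) => psi (f i) = false)
    (nbhs chi) (nbhs_filter chi)) => i.
  exact: (open_nbhs_nbhs (conj (open_evalF (f i)) (cf i))).
by apply: filterS (filterI nb1 nb2) => psi [pe pf]; exists n, e, f.
Qed.


End CharacterTheory.

Section TestEq.
Variable C : lcCategory.
Lemma Omega_cut chi n (g h : J C) (f : 'I_n -> J C) : Omega C chi ->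
  val g `<=` val h `|` \bigcup_i val (f i) -> (forall i, chi (f i) = false) ->
  chi g -> chi h.
Proof.
move=> [[_ chiM _] chiO] sub cf cg.
have [|i] := chiO n.+1 g (fun i => Jmeet g (oapp f h (unlift ord0 i))) _ cg.
  apply/seteqP; split => x /=; last by move=> [i _ []].
  move=> gx; have [hx|[i _ fx]] := sub x gx.
    by exists ord0 => //; rewrite unlift_none.
  by exists (lift ord0 i) => //; rewrite liftK.
by rewrite chiM cg; case: unliftP => [j _|_] //=; rewrite cf.
Qed.

Lemma bar_holds_eq chi E (e f : J C) : Omega C chi -> bar_holds chi E ->
  E `&` val e = E `&` val f -> chi e = chi f.
Proof.
move=> chiO [n [g [h [hg -> cg ch]]]].
have [[_ chiM _] _] := chiO.
suff H e1 e2 : (val g `\` \bigcup_i val (h i)) `&` val e1 =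
    (val g `\` \bigcup_i val (h i)) `&` val e2 -> chi e1 -> chi e2.
  by move=> ef; apply/idP/idP; exact: H.
move=> e12 c1; apply: (@Omega_cut _ _ (Jmeet g e1) _ h chiO) => //.
  move=> x [gx e1x]; have [hx|nh] := pselect ((\bigcup_i val (h i)) x); first by right.
  left; have : ((val g `\` \bigcup_i val (h i)) `&` val e1) x by [].
  by rewrite e12 => -[].
by rewrite chiM cg.
Qed.

Lemma holds_eq chi E (e f : J C) : Omega C chi -> holds chi E ->
  E `&` val e = E `&` val f -> chi e = chi f.
Proof. by move=> chiO /(holds_bar chiO.1); exact: bar_holds_eq. Qed.
End TestEq.

Record invariantSpace (C : lcCategory) := InvariantSpace {
  inv_set : set (charspace C);
  inv_sub : inv_set `<=` Omega C;
  inv_act : forall s chi, inv_set chi -> chi (Jdom s) -> inv_set (act s chi)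
}.

Definition Omega_space (C : lcCategory) : invariantSpace C :=
  InvariantSpace (@subset_refl _ (Omega C)) (@act_Omega C).

Definition bdOmega_space (C : lcCategory) : invariantSpace C :=
  InvariantSpace (@bdOmega_sub C) (@act_bdOmega C).

(* The two equivalence relations ~ and \bar ~ differ only in the sets E on which
   two partial bijections are required to agree at chi: [test chi E] is [holds]
   for the former and [bar_holds] for the latter. *)
Record germTest (C : lcCategory) := GermTest {
  test :> charspace C -> set C -> Prop;
  test_holds : forall chi E, Jhat C chi -> holds chi E -> test chi E;
  testI : forall chi E F, Jhat C chi ->
    test chi E -> test chi F -> test chi (E `&` F);
  test_pre : forall s chi E, test (act s chi) E -> test chi (pbij_pre (val s) E);
  test_eq : forall chi E (e f : J C), Omega C chi -> test chi E ->
    E `&` val e = E `&` val f -> chi e = chi f;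
  test_open : forall E, open [set chi | test chi E]
}.

Definition J_test (C : lcCategory) : germTest C :=
  GermTest (fun _ _ _ h => h) (@holdsI C) (@holds_pre C) (@holds_eq C)
    (@holds_open C).

Definition Jbar_test (C : lcCategory) : germTest C :=
  GermTest (@holds_bar C) (@bar_holdsI C) (@bar_holds_pre C) (@bar_holds_eq C)
    (@bar_holds_open C).

Section Germs.
Variables (C : lcCategory) (Y : invariantSpace C) (P : germTest C).

Definition germ_dom (s : Il C) : set (charspace C) :=
  [set chi | inv_set Y chi /\ chi (Jdom s)].

(* The pairs (s, chi), with I_l discrete: disjoint union topology. *)
Definition pregerm := {s : Il C & germ_dom s}.

HB.instance Definition _ := Topological.on pregerm.

Definition germ_rel (p q : pregerm) : bool :=
  `[< val (projT2 p) = val (projT2 q) /\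
      exists2 E, P (val (projT2 p)) E &
        pbij_restr (val (projT1 p)) E = pbij_restr (val (projT1 q)) E >].

Lemma inv_Jhat chi : inv_set Y chi -> Jhat C chi.
Proof. by move=> /inv_sub []. Qed.

Lemma pregermP (p : pregerm) : germ_dom (projT1 p) (val (projT2 p)).
Proof. exact/set_mem/valP. Qed.

Lemma germ_rel_refl : reflexive germ_rel.
Proof.
move=> p; apply/asboolP; split => //.
have [pY _] := pregermP p; have [[e pe] _ _] := inv_Jhat pY.
by exists (val e) => //; apply: test_holds; [exact: inv_Jhat|exists e].
Qed.

Lemma germ_rel_sym : symmetric germ_rel.
Proof.
suff H p q : germ_rel p q -> germ_rel q p by move=> p q; apply/idP/idP; exact: H.
move=> /asboolP[pq [E PE sE]]; apply/asboolP; split => //.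
by exists E => //; rewrite -pq.
Qed.

Lemma germ_rel_trans : transitive germ_rel.
Proof.
move=> q p r /asboolP[pq [E PE /pbij_restrP sE]] /asboolP[qr [F PF /pbij_restrP sF]].
have [pY _] := pregermP p.
apply/asboolP; split; first by rewrite pq.
exists (E `&` F).
  by apply: testI => //; [exact: inv_Jhat|rewrite pq].
by apply/pbij_restrP => x [Ex Fx]; rewrite sE// sF.
Qed.

Canonical germ_equiv := EquivRel germ_rel germ_rel_refl germ_rel_sym germ_rel_trans.

(* For the quotient topology, the image of {s} x {chi in Y : chi(s^-1 s) = 1} is
   open, and the source map restricted to it is a homeomorphism onto
   {chi in Y : chi(s^-1 s) = 1}; see [germ_image_open] and [nbhs_germ]. *)
Definition germs := quotient_topology {eq_quot germ_equiv}%qT.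

HB.instance Definition _ := Topological.on germs.
HB.instance Definition _ := Quotient.on germs.

(* The class [s, chi]. *)
Definition germ (s : Il C) (chi : charspace C) (h : germ_dom s chi) : germs :=
  \pi_germs%qT (existT _ s (exist _ chi (mem_set h)) : pregerm).

Lemma germE s chi (h : germ_dom s chi) t psi (k : germ_dom t psi) :
  germ h = germ k <-> chi = psi /\ exists2 E, P chi E &
    pbij_restr (val s) E = pbij_restr (val t) E.
Proof. by split=> [/eqmodP/asboolP|?]; [|apply/eqmodP/asboolP]. Qed.

Lemma germP g : exists s chi (h : germ_dom s chi), g = germ h.
Proof.
elim/quotW: g => -[s [chi h]]; exists s, chi, (set_mem h).
by congr (\pi_germs%qT _); congr existT; exact: val_inj.
Qed.

Definition germ_src_fun (g : germs) : charspace C := val (projT2 (repr g)).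
Definition germ_rng_fun (g : germs) : charspace C :=
  act (projT1 (repr g)) (germ_src_fun g).

Lemma germ_src_subproof g : germ_src_fun g \in inv_set Y.
Proof. by apply/mem_set; have [] := pregermP (repr g). Qed.
Definition germ_src g : inv_set Y :=
  exist (fun chi => chi \in inv_set Y) _ (germ_src_subproof g).

Lemma germ_rng_subproof g : germ_rng_fun g \in inv_set Y.
Proof. by apply/mem_set; have [gY gD] := pregermP (repr g); exact: inv_act. Qed.
Definition germ_rng g : inv_set Y :=
  exist (fun chi => chi \in inv_set Y) _ (germ_rng_subproof g).

Lemma germ_mul_dom s t chi (h : germ_dom t chi) :
  (act t chi) (Jdom s) -> germ_dom (Il_comp s t) chi.
Proof. by case: h => hY hD sD; split => //; rewrite dom_compE. Qed.

(* Only meaningful when [germ_src g = germ_rng h]. *)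
Definition germ_mul (g h : germs) : germs :=
  if pselect (germ_dom (Il_comp (projT1 (repr g)) (projT1 (repr h)))
                (germ_src_fun h)) is left gh then germ gh else g.

Lemma germ_inv_dom s chi (h : germ_dom s chi) : germ_dom (Il_inv s) (act s chi).
Proof. by case: h => hY hD; split; [exact: inv_act|rewrite act_range]. Qed.

Definition germ_inv (g : germs) : germs :=
  germ (germ_inv_dom (pregermP (repr g))).

Lemma one_subproof (y : inv_set Y) : exists e, val y e.
Proof. by have [] := inv_Jhat (set_mem (valP y)). Qed.

Lemma Jdom_id (e : J C) : Jdom (Jid e) = e.
Proof.
apply: val_inj; apply/seteqP; split => x /=; first by move=> [y /prestrP[]].
by move=> ex; exists x; exact/prestrP.
Qed.

Lemma germ_one_dom (y : inv_set Y) e : val y e -> germ_dom (Jid e) (val y).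
Proof. by move=> ye; split; [exact/set_mem/valP|rewrite Jdom_id]. Qed.

(* The class [e, chi] for any idempotent e with chi(e) = 1, see [germ_oneE]. *)
Definition germ_one (y : inv_set Y) : germs :=
  germ (germ_one_dom (svalP (cid (one_subproof y)))).

Lemma germ_reprE s chi (h : germ_dom s chi) :
  germ_src_fun (germ h) = chi /\ exists2 E, P chi E &
    forall x, E x -> val (projT1 (repr (germ h))) x = val s x.
Proof.
have : germ h = germ (pregermP (repr (germ h))).
  rewrite -[LHS]reprK /germ /=; congr (\pi_germs%qT _).
  by case: (repr _) => t y; congr existT; exact: val_inj.
move=> /germE[e [E PE /pbij_restrP sE]]; split; first by [].
by exists E => // x /sE.
Qed.

Lemma germ_srcE s chi (h : germ_dom s chi) : val (germ_src (germ h)) = chi.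
Proof. by have [] := germ_reprE h. Qed.

Lemma act_agree (s t : Il C) chi E : inv_set Y chi -> P chi E ->
  (forall x, E x -> val s x = val t x) -> act s chi = act t chi.
Proof.
move=> chiY PE st; apply/funext => e.
apply: (test_eq (inv_sub chiY) PE); apply/seteqP; split => x /= [Ex [y sy ey]].
  by split => //; exists y; rewrite // -st.
by split => //; exists y; rewrite // st.
Qed.

Lemma germ_rngE s chi (h : germ_dom s chi) :
  val (germ_rng (germ h)) = act s chi.
Proof.
have [e [E PE sE]] := germ_reprE h; rewrite /= /germ_rng_fun e.
by apply: act_agree h.1 PE sE.
Qed.

(* [s, t.chi][t, chi] = [st, chi] *)
Lemma germ_mulE s t chi (k : germ_dom t chi) (h : germ_dom s (act t chi))
    (hk : germ_dom (Il_comp s t) chi) :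
  germ_mul (germ h) (germ k) = germ hk.
Proof.
have [e [E PE sE]] := germ_reprE h; have [e' [F PF tF]] := germ_reprE k.
have chiJ := inv_Jhat k.1.
have tr : act (projT1 (repr (germ k))) chi = act t chi.
  exact: act_agree k.1 PF tF.
rewrite /germ_mul; case: pselect => [hk'|[]]; last first.
  have := pregermP (repr (germ k)); rewrite -/(germ_src_fun (germ k)) e' => k1.
  have := pregermP (repr (germ h)); rewrite -/(germ_src_fun (germ h)) e => h1.
  by apply: (germ_mul_dom k1); rewrite tr; case: h1.
apply/germE; split => //.
exists (F `&` pbij_pre (val t) E).
  by rewrite e'; apply: testI => //; exact: test_pre.
apply/pbij_restrP => x [Fx [y ty Ey]] /=.
by rewrite /pcomp tF// ty /= sE.
Qed.

Lemma germ_invE s chi (h : germ_dom s chi) (k : germ_dom (Il_inv s) (act s chi)) :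
  germ_inv (germ h) = germ k.
Proof.
have [e [E PE sE]] := germ_reprE h; have [hY hD] := h.
have act_eq : act (projT1 (repr (germ h))) chi = act s chi.
  exact: act_agree hY PE sE.
apply/germE; rewrite -/(germ_src_fun (germ h)) e; split => //.
rewrite act_eq; exists (pbij_pre (val (Il_inv s)) E).
  by apply: test_pre; rewrite act_inv//; exact: inv_Jhat.
apply/pbij_restrP => y [x sx Ex].
rewrite [RHS]sx /=; apply/pfunP; rewrite sE//.
exact/pfunP.
Qed.

Lemma germ_oneE (y : inv_set Y) e (h : germ_dom (Jid e) (val y)) :
  germ_one y = germ h.
Proof.
rewrite /germ_one; case: cid => /= f yf.
apply/germE; split => //; have ye : val y e by have [_] := h; rewrite Jdom_id.
have yJ := inv_Jhat h.1.
exists (val (Jmeet e f)).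
  by apply: test_holds => //; exists (Jmeet e f) => //; case: yJ => _ -> _; rewrite ye.
by apply/pbij_restrP => x [ex fx] /=; rewrite /prestr !asboolT.
Qed.

Lemma germ_src_one y : germ_src (germ_one y) = y.
Proof. by apply: val_inj; rewrite germ_srcE. Qed.

Lemma act_id e (chi : charspace C) : Jhat C chi -> chi e -> act (Jid e) chi = chi.
Proof.
move=> [_ chiM _] ce; apply/funext => f; rewrite /act.
rewrite (_ : Jpre _ f = Jmeet e f) ?chiM ?ce//.
apply: val_inj; apply/seteqP; split => x /=.
  by move=> [y /prestrP[ex [<-]]].
by move=> [ex fx]; exists x => //; exact/prestrP.
Qed.

Lemma germ_rng_one y : germ_rng (germ_one y) = y.
Proof.
apply: val_inj; rewrite germ_rngE act_id//; last exact: (svalP (cid (one_subproof y))).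
by apply: inv_Jhat; exact/set_mem/valP.
Qed.

Lemma germ_composable g k : germ_src g = germ_rng k ->
  exists s t chi (h : germ_dom s (act t chi)) (k' : germ_dom t chi)
    (hk : germ_dom (Il_comp s t) chi), g = germ h /\ k = germ k'.
Proof.
have [s [psi [h ->]]] := germP g; have [t [chi [k' ->]]] := germP k.
move=> /(congr1 val); rewrite germ_srcE germ_rngE => ?; subst psi.
exists s, t, chi, h, k'; have [hY hD] := h.
by exists (germ_mul_dom k' hD).
Qed.

Lemma germ_src_mul g k : germ_src g = germ_rng k ->
  germ_src (germ_mul g k) = germ_src k.
Proof.
move=> /germ_composable[s [t [chi [h [k' [hk [-> ->]]]]]]].
by apply: val_inj; rewrite germ_mulE !germ_srcE.
Qed.

Lemma germ_rng_mul g k : germ_src g = germ_rng k ->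
  germ_rng (germ_mul g k) = germ_rng g.
Proof.
move=> /germ_composable[s [t [chi [h [k' [hk [-> ->]]]]]]].
by apply: val_inj; rewrite germ_mulE !germ_rngE act_comp.
Qed.

Lemma germ_eq s t chi (h : germ_dom s chi) (k : germ_dom t chi) :
  (forall x, val s x = val t x) -> germ h = germ k.
Proof.
move=> st; have e : s = t by apply: val_inj; exact: pbij_eq.
by subst t; congr germ; exact: Prop_irrelevance.
Qed.

Lemma germ_cast s chi psi (h : germ_dom s chi) (k : germ_dom s psi) :
  chi = psi -> germ h = germ k.
Proof. by move=> e; subst psi; exact: germ_eq. Qed.

Lemma germ_eq_on s t chi (h : germ_dom s chi) (k : germ_dom t chi) (e : J C) :
  chi e -> (forall x, val e x -> val s x = val t x) -> germ h = germ k.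
Proof.
move=> ce st; apply/germE; split => //; exists (val e); last exact/pbij_restrP.
by apply: test_holds; [exact: inv_Jhat h.1|exists e].
Qed.

Lemma germ_mulA f g h : germ_src f = germ_rng g -> germ_src g = germ_rng h ->
  germ_mul f (germ_mul g h) = germ_mul (germ_mul f g) h.
Proof.
move=> fg /germ_composable[s [t [chi [hs [ht [hst [? ?]]]]]]]; subst g h.
have [r [psi [hr ?]]] := germP f; subst f.
move: fg => /(congr1 val); rewrite germ_srcE germ_rngE => ?; subst psi.
have hrs : germ_dom (Il_comp r s) (act t chi).
  by apply: (germ_mul_dom hs); exact: hr.2.
have hr' : germ_dom r (act (Il_comp s t) chi) by rewrite act_comp.
have e : germ hr = germ hr' by apply: germ_cast; rewrite act_comp.
have h1 : germ_dom (Il_comp r (Il_comp s t)) chi.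
  by apply: (germ_mul_dom hst); exact: hr'.2.
have h2 : germ_dom (Il_comp (Il_comp r s) t) chi.
  by apply: (germ_mul_dom ht); exact: hrs.2.
rewrite (germ_mulE _ _ hst) e (germ_mulE _ _ h1) -e.
rewrite (germ_mulE _ _ hrs) (germ_mulE _ _ h2).
apply: germ_eq => x /=; rewrite /pcomp; case: (val t x) => //= y.
Qed.

Lemma germ_mul1 g : germ_mul g (germ_one (germ_src g)) = g.
Proof.
have [s [chi [h ->]]] := germP g; have [hY hD] := h.
have ye : val (germ_src (germ h)) (Jdom s) by rewrite germ_srcE.
rewrite (germ_oneE (germ_one_dom ye)).
have chie : val (germ_src (germ h)) = chi := germ_srcE h.
move: (germ_one_dom ye); rewrite chie => k.
have h' : germ_dom s (act (Jid (Jdom s)) chi) by rewrite act_id//; exact: inv_Jhat.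
have e : germ h = germ h'.
  by apply: germ_cast; rewrite act_id//; exact: inv_Jhat.
have hk : germ_dom (Il_comp s (Jid (Jdom s))) chi.
  by apply: (germ_mul_dom k); exact: h'.2.
rewrite [in LHS]e (germ_mulE _ _ hk).
apply: (@germ_eq_on _ _ _ _ _ (Jdom s)) => // x sx /=.
by rewrite /pcomp /prestr asboolT.
Qed.

Lemma germ_1mul g : germ_mul (germ_one (germ_rng g)) g = g.
Proof.
have [s [chi [h ->]]] := germP g; have [hY hD] := h.
have ye : val (germ_rng (germ h)) (Jdom (Il_inv s)) by rewrite germ_rngE act_range.
rewrite (germ_oneE (germ_one_dom ye)).
have chie : val (germ_rng (germ h)) = act s chi := germ_rngE h.
move: (germ_one_dom ye); rewrite chie => k.
have hk : germ_dom (Il_comp (Jid (Jdom (Il_inv s))) s) chi.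
  by apply: (germ_mul_dom h); exact: k.2.
rewrite (germ_mulE _ _ hk).
apply: (@germ_eq_on _ _ _ _ _ (Jdom s)) => // x [y sy] /=.
rewrite /pcomp sy /= /prestr asboolT//.
by exists x; exact/pfunP.
Qed.

Lemma germ_src_inv g : germ_src (germ_inv g) = germ_rng g.
Proof.
have [s [chi [h ->]]] := germP g.
apply: val_inj; rewrite (germ_invE _ (germ_inv_dom h)) germ_srcE.
by rewrite germ_rngE.
Qed.

Lemma germ_rng_inv g : germ_rng (germ_inv g) = germ_src g.
Proof.
have [s [chi [h ->]]] := germP g.
apply: val_inj; rewrite (germ_invE _ (germ_inv_dom h)) germ_srcE germ_rngE act_inv//.
  exact: inv_Jhat h.1.
by case: h.
Qed.

Lemma germ_invV g : germ_inv (germ_inv g) = g.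
Proof.
have [s [chi [h ->]]] := germP g.
rewrite (germ_invE _ (germ_inv_dom h)) (germ_invE _ (germ_inv_dom (germ_inv_dom h))).
apply/germE; rewrite act_inv//; [|exact: inv_Jhat h.1|by case: h].
split => //; have /germE[_ [E ? _]] := erefl (germ h); exists E => //.
exact/pbij_restrP.
Qed.

Lemma germ_mulV g : germ_mul (germ_inv g) g = germ_one (germ_src g).
Proof.
have [s [chi [h ->]]] := germP g; have [hY hD] := h.
rewrite (germ_invE _ (germ_inv_dom h)).
have hk : germ_dom (Il_comp (Il_inv s) s) chi.
  by apply: (germ_mul_dom h); case: (germ_inv_dom h).
rewrite (germ_mulE _ _ hk).
have ye : val (germ_src (germ h)) (Jdom s) by rewrite germ_srcE.
rewrite (germ_oneE (germ_one_dom ye)).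
apply/germE; split; first by rewrite germ_srcE.
exists (val (Jdom s)).
  by apply: test_holds; [exact: inv_Jhat hY|exists (Jdom s)].
apply/pbij_restrP => x xs /=; rewrite /pcomp /prestr asboolT//.
by have [y sy] := xs; rewrite sy /=; apply/pfunP.
Qed.

Lemma germ_Vmul g : germ_mul g (germ_inv g) = germ_one (germ_rng g).
Proof. by rewrite -{1}(germ_invV g) germ_mulV germ_src_inv. Qed.


Lemma germs_openP (U : set germs) : open U <-> forall s,
  open [set x : germ_dom s | U (\pi_germs%qT (existT _ s x : pregerm))].
Proof. exact: sigT_openP. Qed.

Lemma germ_image_open s (V : set (charspace C)) : open V ->
  open [set g | exists chi (h : germ_dom s chi), V chi /\ g = germ h].
Proof.
move=> oV; apply/germs_openP => t.
pose W := [set chi : charspace C | V chi /\ chi (Jdom s) /\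
  exists2 E, pbij_restr (val s) E = pbij_restr (val t) E & P chi E].
rewrite (_ : [set _ | _] = val @^-1` W).
  have /continuousP := @set_val_continuous _ (germ_dom t); apply.
  rewrite (_ : W = V `&` ([set chi : charspace C | chi (Jdom s)] `&`
    \bigcup_(E in [set E | pbij_restr (val s) E = pbij_restr (val t) E])
      [set chi : charspace C | P chi E])) //.
  apply: openI => //; apply: openI; first exact: open_eval.
  by apply: bigcup_open => E _; exact: test_open.
apply/seteqP; split => -[psi k] /=.
  move=> [chi [h [Vchi e]]].
  have /esym/germE[? [E PE sE]] : germ (set_mem k) = germ h.
    by rewrite -e; congr (\pi_germs%qT _); congr existT; exact: val_inj.
  subst psi; split => //; split; first exact: h.2.
  by exists E.
move=> [Vpsi [psis [E sE PE]]].
have h : germ_dom s psi by split => //; case: (set_mem k).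
exists psi, h; split => //; transitivity (germ (set_mem k)).
  by congr (\pi_germs%qT _); congr existT; exact: val_inj.
by apply/germE; split => //; exists E.
Qed.

Lemma nbhs_germ s chi (h : germ_dom s chi) (A : set germs) :
  nbhs (germ h) A <-> exists V : set (charspace C), [/\ open V, V chi &
    forall psi (k : germ_dom s psi), V psi -> A (germ k)].
Proof.
split=> [|[V [oV Vchi VA]]].
  rewrite nbhsE => -[W [oW Wh] WA].
  have [V oV VE] := (germs_openP W).1 oW s.
  have VW psi (k : germ_dom s psi) : V psi <-> W (germ k).
    pose x : germ_dom s := exist _ psi (mem_set k).
    suff -> : V psi = (val @^-1` V) x by rewrite VE.
    by [].
  exists V; split => //; first exact/VW.
  by move=> psi k /VW /WA.
apply: filterS (open_nbhs_nbhs (conj (@germ_image_open s _ oV) _)).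
  by move=> _ [psi [k [Vpsi ->]]]; exact: VA.
by exists chi, h.
Qed.

Lemma germs_continuous (Z : topologicalType) (f : germs -> Z)
    (F : Il C -> charspace C -> Z) : (forall s, continuous (F s)) ->
  (forall s chi (h : germ_dom s chi), f (germ h) = F s chi) -> continuous f.
Proof.
move=> cF fF g; have [s [chi [h ->]]] := germP g.
move=> A; rewrite fF => /cF; rewrite nbhsE => -[V [oV Vchi] VA].
by apply/nbhs_germ; exists V; split => // psi k /VA /=; rewrite -fF.
Qed.

Lemma germ_src_continuous : continuous germ_src.
Proof.
apply: to_set_continuous; apply: (@germs_continuous _ _ (fun=> id)).
  by move=> s x.
by move=> s chi h; rewrite germ_srcE.
Qed.

Lemma germ_rng_continuous : continuous germ_rng.
Proof.
apply: to_set_continuous; apply: (@germs_continuous _ _ (@act C)).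
  exact: act_continuous.
by move=> s chi h; rewrite germ_rngE.
Qed.

Lemma germ_inv_continuous : continuous germ_inv.
Proof.
move=> g; have [s [chi [h ->]]] := germP g.
move=> A; rewrite (germ_invE _ (germ_inv_dom h)) => /nbhs_germ[V [oV Vchi VA]].
apply/nbhs_germ; exists (act s @^-1` V); split => //.
  by have /continuousP := @act_continuous C s; exact.
by move=> psi k Vpsi /=; rewrite (germ_invE _ (germ_inv_dom k)); exact: VA.
Qed.

Lemma germ_one_continuous : continuous germ_one.
Proof.
move=> y A; have [e ye] := one_subproof y.
rewrite (germ_oneE (germ_one_dom ye)) => /nbhs_germ[V [oV Vchi VA]].
pose W := V `&` [set chi : charspace C | chi e].
have oW : open W by apply: openI => //; exact: open_eval.
have cv := @set_val_continuous _ (inv_set Y).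
have : nbhs y (val @^-1` W).
  by apply: cv; exact: (open_nbhs_nbhs (conj oW (conj Vchi ye))).
apply: (@filterS _ (nbhs y) (nbhs_filter y)) => z [Vz ze] /=.
by rewrite (germ_oneE (germ_one_dom ze)); exact: VA.
Qed.

Lemma germ_mul_continuous :
  {within [set p | germ_src p.1 = germ_rng p.2],
    continuous (fun p : germs * germs => germ_mul p.1 p.2)}.
Proof.
apply/subspace_continuousP => -[g k] /= gk.
have [s [t [chi [h [k' [hk [? ?]]]]]]] := germ_composable gk; subst g k.
rewrite /from_subspace => A.
change (nbhs (germ_mul (germ h) (germ k')) A ->
  within [set p : germs * germs | germ_src p.1 = germ_rng p.2]
    (nbhs (germ h, germ k')) ((fun p => germ_mul p.1 p.2) @^-1` A)).
rewrite (germ_mulE _ _ hk) => /nbhs_germ[V [oV Vchi VA]].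
exists ([set g | exists chi (h : germ_dom s chi), setT chi /\ g = germ h],
        [set g | exists chi (h : germ_dom t chi), V chi /\ g = germ h]).
  split => /=; apply: open_nbhs_nbhs; split.
  - by apply: germ_image_open; exact: openT.
  - by exists (act t chi), h.
  - exact: germ_image_open.
  - by exists chi, k'.
move=> [g1 g2] /= [[psi1 [h1 [_ ->]]] [psi [h2 [Vpsi ->]]]].
move=> /(congr1 val); rewrite germ_srcE germ_rngE => ?; subst psi1.
have h12 : germ_dom (Il_comp s t) psi by apply: (germ_mul_dom h2); exact: h1.2.
by rewrite /= (germ_mulE _ _ h12); exact: VA.
Qed.

End Germs.

(* [mul g h] is only meaningful when [src g = rng h]. *)
Record topGroupoid := TopGroupoid {
  arrows :> topologicalType;
  units : topologicalType;
  src : arrows -> units;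
  rng : arrows -> units;
  one : units -> arrows;
  inv : arrows -> arrows;
  mul : arrows -> arrows -> arrows;
  src_one : forall x, src (one x) = x;
  rng_one : forall x, rng (one x) = x;
  src_mul : forall g h, src g = rng h -> src (mul g h) = src h;
  rng_mul : forall g h, src g = rng h -> rng (mul g h) = rng g;
  mulA : forall f g h, src f = rng g -> src g = rng h ->
    mul f (mul g h) = mul (mul f g) h;
  mul1 : forall g, mul g (one (src g)) = g;
  mul1l : forall g, mul (one (rng g)) g = g;
  src_inv : forall g, src (inv g) = rng g;
  rng_inv : forall g, rng (inv g) = src g;
  mulVl : forall g, mul (inv g) g = one (src g);
  mulVr : forall g, mul g (inv g) = one (rng g);
  src_continuous : continuous src;
  rng_continuous : continuous rng;
  one_continuous : continuous one;
  inv_continuous : continuous inv;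
  mul_continuous :
    {within [set p | src p.1 = rng p.2], continuous (fun p => mul p.1 p.2)}
}.

Definition groupoid_morphism (G H : topGroupoid) (f : G -> H) :=
  forall g h, src g = rng h ->
    src (f g) = rng (f h) /\ f (mul g h) = mul (f g) (f h).

Definition topGroupoid_iso (G H : topGroupoid) (f : G -> H) :=
  [/\ groupoid_morphism f, continuous f &
    exists f' : H -> G,
      [/\ cancel f f', cancel f' f, groupoid_morphism f' & continuous f']].

Definition germ_groupoid (C : lcCategory) (Y : invariantSpace C)
    (P : germTest C) : topGroupoid :=
  TopGroupoid (@germ_src_one C Y P) (@germ_rng_one C Y P)
    (@germ_src_mul C Y P) (@germ_rng_mul C Y P) (@germ_mulA C Y P)
    (@germ_mul1 C Y P) (@germ_1mul C Y P) (@germ_src_inv C Y P)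
    (@germ_rng_inv C Y P) (@germ_mulV C Y P) (@germ_Vmul C Y P)
    (@germ_src_continuous C Y P) (@germ_rng_continuous C Y P)
    (@germ_one_continuous C Y P) (@germ_inv_continuous C Y P)
    (@germ_mul_continuous C Y P).

(* I_l \ltimes Y *)
Definition transformation_groupoid (C : lcCategory) (Y : invariantSpace C) :=
  germ_groupoid Y (J_test C).

(* I_l \bar\ltimes Y *)
Definition bar_transformation_groupoid (C : lcCategory)
    (Y : invariantSpace C) :=
  germ_groupoid Y (Jbar_test C).

(* Sends the ~-class [s, chi] to the \bar ~-class [s, chi], see
   [canonical_projectionE]. *)
Definition canonical_projection (C : lcCategory) (Y : invariantSpace C)
    (g : transformation_groupoid Y) : bar_transformation_groupoid Y :=
  germ (Jbar_test C) (pregermP (repr (g : germs Y (J_test C)))).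

Lemma canonical_projectionE (C : lcCategory) (Y : invariantSpace C) s chi
    (h : germ_dom Y s chi) :
  canonical_projection (germ (J_test C) h) = germ (Jbar_test C) h.
Proof.
have [e [E PE sE]] := germ_reprE (J_test C) h.
apply/germE; rewrite -/(germ_src_fun (germ (J_test C) h)) e; split => //.
exists E; first by apply: holds_bar => //; exact: inv_Jhat h.1.
exact/pbij_restrP.
Qed.

(* Main.v *)
Require Import Defs.
From mathcomp Require Import all_boot all_classical all_reals topology.

(** The projection is always a continuous open surjective morphism, so it is an
    isomorphism of topological groupoids as soon as it is injective
    ([canonical_projection_iso]); injectivity says that two partial bijections
    that agree on some e \ (f_1 u ... u f_n) on which chi is 1 also agree on some
    e' in J with chi(e') = 1.

    The main point is that this holds at every maximal character chi. If
    chi(f_i) = 0, maximality yields e_i in J disjoint from f_i with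
    chi(e_i) = 1, for otherwise chi^-1(1) and f_i would together generate a
    strictly larger character ([Omega_max_separation]). Hence e cut with all
    the e_i is an element of J, contained in e \ (f_1 u ... u f_n), on which chi
    is 1 ([Omega_max_bar_holds]). This settles (iii). Under (i), injectivity
    passes from Omega to its subspace, because the two equivalence relations
    only involve chi itself.

    Under (ii), suppose that [s, chi] and [t, chi] are distinct but agree on some
    epsilon with chi(epsilon) = 1. Since the groupoid is Hausdorff, [s, psi] and
    [t, psi] remain distinct for all psi near chi, and also psi(epsilon) = 1 for
    such psi. As chi lies in the closure of Omega_max, psi may be taken maximal,
    which contradicts the previous paragraph. *)

Set Implicit Arguments.
Unset Strict Implicit.
Unset Printing Implicit Defensive.

Local Open Scope classical_set_scope.

Section Projection.
Variables (C : lcCategory) (Y : invariantSpace C).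

(** The canonical projection is injective on arrows, spelled out on
    representatives. *)
Definition bar_germ_inj :=
  forall s t chi (h : germ_dom Y s chi) (k : germ_dom Y t chi),
    germ (Jbar_test C) h = germ (Jbar_test C) k ->
    germ (J_test C) h = germ (J_test C) k.

Lemma canonical_projection_inj :
  injective (@canonical_projection C Y) -> bar_germ_inj.
Proof.
by move=> inj s t chi h k hk; apply: inj; rewrite !canonical_projectionE.
Qed.

(** A class for the relation tested on differences e \ (f_1 u ... u f_n) is sent
    to the finer class, tested on J only, of a chosen representative; the choice
    is irrelevant under [bar_germ_inj]. *)
Definition projection_inv (g : bar_transformation_groupoid Y) :
    transformation_groupoid Y :=
  germ (J_test C) (pregermP (repr (g : germs Y (Jbar_test C)))).

Lemma projection_invE : bar_germ_inj -> forall s chi (h : germ_dom Y s chi),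
  projection_inv (germ (Jbar_test C) h) = germ (J_test C) h.
Proof.
move=> inj s chi h; rewrite /projection_inv.
have [e [E PE sE]] := germ_reprE (Jbar_test C) h.
have k := pregermP (repr (germ (Jbar_test C) h)).
have k' : germ_dom Y (projT1 (repr (germ (Jbar_test C) h))) chi.
  by rewrite -[X in germ_dom _ _ X]e.
rewrite (germ_cast _ _ k')//; apply: inj; apply/germE; split => //.
by exists E => //; exact/pbij_restrP.
Qed.

Lemma canonical_projection_iso : bar_germ_inj ->
  topGroupoid_iso (@canonical_projection C Y).
Proof.
move=> inj; split.
- move=> /= g k /germ_composable[s [t [chi [h [k' [hk [-> ->]]]]]]].
  rewrite !canonical_projectionE; split.
    by apply: val_inj; rewrite germ_srcE germ_rngE.
  by rewrite (germ_mulE _ _ _ hk) (germ_mulE _ _ _ hk) canonical_projectionE.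
- move=> g; have [s [chi [h ->]]] := germP g.
  move=> A; rewrite canonical_projectionE => /nbhs_germ[V [oV Vchi VA]].
  apply/nbhs_germ; exists V; split => // psi k Vpsi /=.
  by rewrite canonical_projectionE; exact: VA.
exists projection_inv; split.
- move=> g; have [s [chi [h ->]]] := germP g.
  by rewrite canonical_projectionE projection_invE.
- move=> g; have [s [chi [h ->]]] := germP g.
  by rewrite projection_invE// canonical_projectionE.
- move=> /= g k /germ_composable[s [t [chi [h [k' [hk [-> ->]]]]]]].
  rewrite !projection_invE//; split.
    by apply: val_inj; rewrite germ_srcE germ_rngE.
  by rewrite (germ_mulE _ _ _ hk) (germ_mulE _ _ _ hk) projection_invE.
- move=> g; have [s [chi [h ->]]] := germP g.
  move=> A; rewrite projection_invE// => /nbhs_germ[V [oV Vchi VA]].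
  apply/nbhs_germ; exists V; split => // psi k Vpsi /=.
  by rewrite projection_invE//; exact: VA.
Qed.

End Projection.

(** For a fixed character, neither equivalence relation on germs depends on the
    invariant space. *)
Lemma bar_germ_injS (C : lcCategory) (Y Z : invariantSpace C) :
  inv_set Z `<=` inv_set Y -> bar_germ_inj Y -> bar_germ_inj Z.
Proof.
move=> ZY injY s t chi h k /germE[_ Est].
have h' : germ_dom Y s chi by split; [exact: ZY h.1|exact: h.2].
have k' : germ_dom Y t chi by split; [exact: ZY k.1|exact: k.2].
have /germE[_ Fst] : germ (J_test C) h' = germ (J_test C) k'.
  by apply: injY; apply/germE.
exact/germE.
Qed.

Section Maximal.
Variable C : lcCategory.

Lemma Omega_max_separation (chi : charspace C) (f : J C) :
  Omega_max C chi -> chi f = false ->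
  exists2 e : J C, chi e & val e `&` val f = set0.
Proof.
move=> [[[e0 ce0] chiM chi0] chimax] cf; apply: contrapT => ns.
(* psi is the character of the filter generated by chi^-1(1) and f *)
pose psi : charspace C := fun g =>
  `[< exists2 e : J C, chi e & val e `&` val f `<=` val g >].
have psiJ : Jhat C psi.
  split.
  - by exists e0; apply/asboolP; exists e0 => // x [].
  - move=> g h; apply/asboolP/andP.
      by move=> [e ce sub]; split; apply/asboolP; exists e => // x /sub [].
    move=> [/asboolP[e1 c1 s1] /asboolP[e2 c2 s2]].
    exists (Jmeet e1 e2); first by rewrite chiM c1.
    by move=> x [[x1 x2] fx]; split; [exact: s1|exact: s2].
  - move=> g g0; apply/asboolP => -[e ce]; rewrite g0 subset0 => e0f.
    by apply: ns; exists e.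
have : chi f; last by rewrite cf.
apply: (chimax psi psiJ).
  by move=> g /= cg; apply/asboolP; exists g => // x [].
by apply/asboolP; exists e0 => // x [].
Qed.

Lemma Omega_max_bar_holds (chi : charspace C) (E : set C) :
  Omega_max C chi -> bar_holds chi E ->
  exists2 e : J C, chi e & val e `<=` E.
Proof.
move=> chimax [n [e [f [_ -> ce cf]]]].
have chiM : forall a b, chi (Jmeet a b) = chi a && chi b by case: chimax.1.
elim: n f cf => [|n IH] f cf.
  by exists e => // x ex; split => // -[[]].
have [m cm me] := IH (fun i => f (lift ord0 i)) (fun=> cf _).
have [g cg g0] := Omega_max_separation chimax (cf ord0).
exists (Jmeet m g); first by rewrite chiM cm.
move=> x [mx gx]; have [ex nf] := me x mx; split => // -[i _ fx].
case: (unliftP ord0 i) fx => [j|] -> fx; first by apply: nf; exists j.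
by suff : (val g `&` val (f ord0)) x by rewrite g0.
Qed.

Lemma bar_germ_max (Y : invariantSpace C) s t chi
    (h : germ_dom Y s chi) (k : germ_dom Y t chi) (E : set C) :
  Omega_max C chi -> bar_holds chi E ->
  pbij_restr (val s) E = pbij_restr (val t) E ->
  germ (J_test C) h = germ (J_test C) k.
Proof.
move=> chimax chiE /pbij_restrP st.
have [e ce eE] := Omega_max_bar_holds chimax chiE.
by apply: (germ_eq_on _ h k ce) => x /eE; exact: st.
Qed.

Lemma Omega_max_bdOmega : Omega_max C `<=` bdOmega C.
Proof. by move=> chi chimax; split; [exact: subset_closure|case: chimax]. Qed.

Lemma bar_germ_inj_hausdorff :
  hausdorff_space (transformation_groupoid (bdOmega_space C)) ->
  bar_germ_inj (bdOmega_space C).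
Proof.
move=> hsd s t chi h k /germE[_ [E chiE st]].
apply: hsd => A B /nbhs_germ[V [oV Vchi VA]] /nbhs_germ[W [oW Wchi WB]].
have [[cl _] hs] := h; have [_ kt] := k.
have nb : nbhs chi (V `&` W `&` ([set psi | bar_holds psi E] `&`
    ([set psi : charspace C | psi (Jdom s)] `&`
     [set psi : charspace C | psi (Jdom t)]))).
  apply: open_nbhs_nbhs; split=> //.
  do !apply: openI => //; [exact: bar_holds_open|exact: open_eval..].
have [psi [psimax [[Vpsi Wpsi] [psiE [ps pt]]]]] := cl _ nb.
have psibd := Omega_max_bdOmega psimax.
have h' : germ_dom (bdOmega_space C) s psi by [].
have k' : germ_dom (bdOmega_space C) t psi by [].
exists (germ (J_test C) h'); split; first exact: VA.
by rewrite (bar_germ_max h' k' psimax psiE st); exact: WB.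
Qed.

Lemma bar_germ_inj_max :
  bdOmega C = Omega_max C -> bar_germ_inj (bdOmega_space C).
Proof.
move=> bdE s t chi h k /germE[_ [E chiE st]].
by apply: bar_germ_max chiE st; rewrite -bdE; exact: h.1.
Qed.

End Maximal.

Theorem lemma3p5 (C : lcCategory) :
  topGroupoid_iso (@canonical_projection C (Omega_space C)) \/
  hausdorff_space (transformation_groupoid (bdOmega_space C)) \/
  bdOmega C = Omega_max C ->
  topGroupoid_iso (@canonical_projection C (bdOmega_space C)).
Proof.
move=> hyp; apply: canonical_projection_iso.
case: hyp => [[_ _ [f [fK _ _ _]]]|[hsd|bdE]].
- apply: (@bar_germ_injS _ (Omega_space C)); first exact: bdOmega_sub.
  exact: canonical_projection_inj (can_inj fK).
- exact: bar_germ_inj_hausdorff.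
- exact: bar_germ_inj_max.
Qed.
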